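(* Let $V$ be a finite nonempty set and let $S\subseteq 2^V$ be a simplicial complex (that is, $A\in S$ and $B\subseteq A$ imply $B\in S$) whose elements have union $V$. Let $H$ be a finite set with $h=|H|$. Suppose there exist $h$ sets $\mathbf{B}_1,\ldots,\mathbf{B}_h\subseteq 2^V$ such that each $\mathbf{B}_j$ is either a star tuple or an edge pair consisting of two sets of cardinality at least $3$, and such that $\mathbf{B}_1,\ldots,\mathbf{B}_h$ cover $\{\Lambda\in S: |\Lambda|\ge 2\}$ in reverse inclusion order. Then every distribution from the hierarchical model $\mathcal{E}_S$ on $\{0,1\}^V$ can be approximated arbitrarily well by distributions from $\mathrm{RBM}_{V,H}$.
   Context: Hierarchical model: $\mathcal{E}_S$ is the set of probability distributions on $\{0,1\}^V$ of the form $p(x)=\frac{1}{Z}\exp\big(\sum_{\Lambda\in S}J_\Lambda\prod_{i\in\Lambda}x_i\big)$ with arbitrary $J_\Lambda\in\mathbb{R}$, where $Z$ is the normalizing constant. Restricted Boltzmann machine: $\mathrm{RBM}_{V,H}$ is the set of probability distributions on $\{0,1\}^V$ of the form $p(x)=\frac1Z\exp(F(x))$ with $$F(x)=\sum_{i\in V}b_ix_i+\sum_{j\in H}\log\Big(1+\exp\Big(\sum_{i\in V}w_{ji}x_i+c_j\Big)\Big),$$ where $b_i,w_{ji},c_j\in\mathbb{R}$ are arbitrary and $Z$ is the normalizing constant (equivalently, $p(x)=\frac1Z\sum_{y\in\{0,1\}^H}\exp(\sum_i b_ix_i+\sum_{j,i}y_jw_{ji}x_i+\sum_jc_jy_j)$).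 A distribution $p$ can be approximated arbitrarily well by distributions from a model $\mathcal{M}$ if for every $\epsilon>0$ there is $q\in\mathcal{M}$ with $\max_x|p(x)-q(x)|\le\epsilon$. A star tuple is a set of the form $\{B\cup\{j\}: j\in B'\}$ with $B,B'\subseteq V$ and $B\cap B'=\emptyset$. An edge pair is a pair of sets $(B,B')$ (regarded here also as the set $\{B,B'\}$), $B,B'\subseteq V$, such that $B\supsetneq B'$ and there is no $C$ with $B\supsetneq C\supsetneq B'$. Sets $\mathbf{B}_1,\ldots,\mathbf{B}_h$ cover a family $\mathcal{F}\subseteq 2^V$ in reverse inclusion order if the members of $\mathcal{F}$ can be covered downwards, from larger sets to smaller sets: there is an assignment $\sigma:\mathcal{F}\to\{1,\ldots,h\}$ with $\Lambda\in\mathbf{B}_{\sigma(\Lambda)}$ for all $\Lambda\in\mathcal{F}$, and $\sigma(\Lambda)\le\sigma(\Lambda')$ whenever $\Lambda,\Lambda'\in\mathcal{F}$ and $\Lambda\supsetneq\Lambda'$. *)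

(* Defs.v *)
From HB Require Import structures.
From mathcomp Require Import all_boot all_order all_algebra.
From mathcomp Require Import reals sequences exp.

Set Implicit Arguments.
Unset Strict Implicit.
Unset Printing Implicit Defensive.

Import Order.TTheory GRing.Theory Num.Theory.
Local Open Scope ring_scope.

Notation config V := {ffun V -> bool}.

Definition gibbs (R : realType) (V : finType) (E : config V -> R)
    (x : config V) : R :=
  expR (E x) / \sum_(y : config V) expR (E y).

Definition hierarchical_energy (R : realType) (V : finType)
    (S : {set {set V}}) (J : {set V} -> R) (x : config V) : R :=
  \sum_(L in S) J L * \prod_(i in L) (x i)%:R.

Definition hierarchical_model (R : realType) (V : finType)
    (S : {set {set V}}) (p : config V -> R) : Prop :=
  exists J : {set V} -> R, forall x, p x = gibbs (hierarchical_energy S J) x.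

(* The negative free energy, the hidden units being summed out. *)
Definition rbm_energy (R : realType) (V H : finType)
    (b : V -> R) (w : H -> V -> R) (c : H -> R) (x : config V) : R :=
  \sum_(i : V) b i * (x i)%:R
  + \sum_(j : H) ln (1 + expR (\sum_(i : V) w j i * (x i)%:R + c j)).

Definition rbm (R : realType) (V H : finType) (p : config V -> R) : Prop :=
  exists (b : V -> R) (w : H -> V -> R) (c : H -> R),
    forall x, p x = gibbs (rbm_energy b w c) x.

(* The default value 0 of the maximum is harmless: absolute values are
   nonnegative and [config V] is never empty. *)
Definition approximable (R : realType) (V : finType)
    (M : (config V -> R) -> Prop) (p : config V -> R) : Prop :=
  forall eps : R, 0 < eps ->
    exists q : config V -> R,
      M q /\ \big[Num.max/0]_(x : config V) `|p x - q x| <= eps.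

Definition simplicial_complex (V : finType) (S : {set {set V}}) : Prop :=
  forall A B : {set V}, A \in S -> B \subset A -> B \in S.

Definition star_tuple (V : finType) (X : {set {set V}}) : Prop :=
  exists B B' : {set V},
    [disjoint B & B'] /\ X = [set j |: B | j in B'].

Definition edge_pair (V : finType) (B B' : {set V}) : Prop :=
  B' \proper B /\ ~ (exists C : {set V}, B' \proper C /\ C \proper B).

(* [sigma] is only defined on members of [F]: a total function
   [{set V} -> 'I_h] would not exist when [h = 0], where an empty [F] must
   still count as covered. *)
Definition covers_reverse_inclusion (V : finType) (h : nat)
    (BB : 'I_h -> {set {set V}}) (F : {set {set V}}) : Prop :=
  exists sigma : {L : {set V} | L \in F} -> 'I_h,
    (forall L : {L : {set V} | L \in F}, val L \in BB (sigma L)) /\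
    (forall L L' : {L : {set V} | L \in F},
       val L' \proper val L -> (sigma L <= sigma L')%N).

(* Main.v *)
Require Import Defs.
From HB Require Import structures.
From mathcomp Require Import all_boot all_order all_algebra.
From mathcomp Require Import reals sequences exp.
From mathcomp Require Import ring lra.

Set Implicit Arguments.
Unset Strict Implicit.
Unset Printing Implicit Defensive.

Import Order.TTheory GRing.Theory Num.Theory.
Local Open Scope ring_scope.

(** The energy of an RBM is an affine function plus one [softplus] of an affine
    function per hidden unit. Since [softplus t] is exponentially close to
    [Num.max 0 t] away from [t = 0], a unit with huge weights approximates, uniformly
    on the finite configuration space, a rectified affine function, and two such
    functions have useful polynomial forms:
    - [star_unit]: [x^B (c0 + \sum_j w_j x_j)], with [w] arbitrary and [c0] large;
    - [edge_unit], for [3 <= #|B|] and [i] outside [B]: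
      [a x^B + b x^(i |: B)] with [a] and [b] arbitrary, plus multiples of the
      monomials [B :\ j] and [i |: B :\ j] for [j] in [B].
    So the unit that corresponds to a star tuple or to an edge pair realizes any
    prescribed coefficients on the sets assigned to it, at the cost of other
    coefficients, possibly very large, on proper subsets of these sets
    ([peelable_star], [peelable_edge]). Subsets belong to the simplicial complex
    and, as the cover goes downwards, they are assigned to later units or have at
    most one element. Going through the units in order, one subtracts the limit
    function of each unit from the remaining energy, and this removes the
    assigned monomials exactly; the only errors are the saturation errors of the
    units ([peel_layers]). In the end an affine function is left, which the
    constant and the biases [b] provide. An energy approximated uniformly up to
    an additive constant gives close Gibbs distributions ([gibbs_continuous]). *)

(** * Gibbs distributions depend continuously on the energy *)

Lemma partition_gt0 (R : realType) (V : finType) (E : config V -> R) :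
  0 < \sum_(x : config V) expR (E x).
Proof.
rewrite (bigD1 [ffun=> false]) //= ltr_pwDl ?expR_gt0 // sumr_ge0 // => x _.
exact: expR_ge0.
Qed.

(** A change of the energy by at most [d], up to the constant [k], which cancels
    in the quotient, costs a factor [expR d] in the numerator and another one in
    the normalizing sum. *)
Lemma gibbs_le (R : realType) (V : finType) (E F : config V -> R) (k d : R)
    (x : config V) :
  (forall y, `|E y - (k + F y)| <= d) -> gibbs E x <= expR (d *+ 2) * gibbs F x.
Proof.
move=> EF; have Zgt0 := @partition_gt0 R V.
have ZF : expR (k - d) * \sum_y expR (F y) <= \sum_y expR (E y).
  rewrite mulr_sumr; apply: ler_sum => y _; rewrite -expRD ler_expR.
  by move: (EF y); rewrite ler_norml => /andP[]; lra.
rewrite /gibbs ler_pdivrMr // mulrA -(ler_pM2r (Zgt0 F)).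
rewrite [leRHS]mulrAC divfK ?gt_eqF //.
apply: (@le_trans _ _ (expR (d *+ 2) * expR (F x) * (expR (k - d) * \sum_y expR (F y)))).
  rewrite mulrA ler_pM2r // -!expRD ler_expR.
  by move: (EF x); rewrite ler_norml => /andP[]; lra.
by rewrite ler_pM2l // mulr_gt0 ?expR_gt0.
Qed.

(** Each of the two values is at most [1 + eps] times the other and both lie in
    the unit interval. *)
Lemma gibbs_continuous (R : realType) (V : finType) (E : config V -> R)
    (eps : R) : 0 < eps ->
  exists2 d : R, 0 < d & forall (F : config V -> R) (k : R),
    (forall y, `|E y - (k + F y)| <= d) ->
    forall x, `|gibbs E x - gibbs F x| <= eps.
Proof.
move=> eps_gt0; exists (ln (1 + eps) / 2); first by rewrite divr_gt0 // ln_gt0; lra.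
move=> F k EF x.
have gibbs_ge0 (G : config V -> R) : 0 <= gibbs G x.
  by rewrite divr_ge0 ?expR_ge0 ?sumr_ge0 // => y _; exact: expR_ge0.
have gibbs_le1 (G : config V -> R) : gibbs G x <= 1.
  by rewrite ler_pdivrMr ?partition_gt0 // mul1r (bigD1 x) //= lerDl sumr_ge0 // => y _; exact: expR_ge0.
have factor : expR ((ln (1 + eps) / 2) *+ 2) = 1 + eps.
  by rewrite -[_ *+ 2]mulr_natr divfK ?pnatr_eq0 // lnK // posrE; lra.
have FE y : `|F y - (- k + E y)| <= ln (1 + eps) / 2.
  by rewrite distrC (_ : _ - F y = E y - (k + F y)) //; ring.
have := gibbs_le x EF; have := gibbs_le x FE; rewrite factor => leF leE.
have := gibbs_le1 E; have := gibbs_le1 F; have := gibbs_ge0 E; have := gibbs_ge0 F.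
by rewrite ler_norml => *; apply/andP; split; nra.
Qed.

(** * Monomials and single hidden units *)

Definition monomial (R : realType) (V : finType) (L : {set V}) (x : config V) : R :=
  \prod_(i in L) (x i)%:R.

Arguments monomial {R V}.

Lemma monomialE (R : realType) (V : finType) (L : {set V}) (x : config V) :
  monomial L x = (L \subset [set i | x i])%:R :> R.
Proof.
case: (boolP (L \subset _)) => [/subsetP Lx | /subsetPn[i iL]].
  by rewrite /monomial big1 // => i /Lx; rewrite inE => ->.
by rewrite inE /monomial (bigD1 i) //= => /negPf->; rewrite mul0r.
Qed.

Lemma monomialU1 (R : realType) (V : finType) (L : {set V}) i (x : config V) :
  i \notin L -> monomial (i |: L) x = (x i)%:R * monomial L x :> R.
Proof. by move=> iL; rewrite /monomial big_setU1. Qed.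

Definition affine (R : realType) (V : finType) (w : V -> R) (c : R)
  (x : config V) : R := \sum_i w i * (x i)%:R + c.

Definition softplus (R : realType) (t : R) : R := ln (1 + expR t).

Lemma softplus_le (R : realType) (t : R) : 0 <= softplus t <= expR t.
Proof.
have e := expR_gt0 t; apply/andP; split; first by rewrite ln_ge0; lra.
by rewrite -ler_expR lnK ?expR_ge1Dx // posrE; lra.
Qed.

Lemma softplusN (R : realType) (t : R) : softplus t = t + softplus (- t).
Proof.
have e := expR_gt0 t; have e' := expR_gt0 (- t).
apply: expR_inj; rewrite expRD !lnK ?posrE; try lra.
by rewrite mulrDr mulr1 expRN divff ?gt_eqF // addrC.
Qed.

(** [l] is the argument of a hidden unit, kept at distance [T] from the kink of
    the limiting rectifier [max 0], and [g] is that rectifier applied to [l]. The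
    disjunction leaves the inactive configurations as inequalities only, so that
    [g] does not depend on the large weights that switch the unit off there. *)
Definition saturated (R : realType) (V : finType) (T : R)
    (l g : config V -> R) : Prop :=
  forall x, (T <= l x /\ g x = l x) \/ (l x <= - T /\ g x = 0).

(** By [softplusN], [softplus t] differs from [Num.max 0 t] by
    [softplus (- `|t|)], hence by at most [expR (- `|t|)]. *)
Lemma saturated_softplus (R : realType) (V : finType) (T : R)
    (l g : config V -> R) : saturated T l g ->
  forall x, `|softplus (l x) - g x| <= expR (- T).
Proof.
move=> sat x; case: (sat x) => -[lT ->].
  have /andP[p0 p1] := softplus_le (- l x).
  rewrite softplusN addrAC subrr add0r ger0_norm //.
  by apply: le_trans p1 _; rewrite ler_expR lerN2.
have /andP[p0 p1] := softplus_le (l x).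
by rewrite subr0 ger0_norm //; apply: le_trans p1 _; rewrite ler_expR.
Qed.

Lemma norm_linear_le (R : realType) (V : finType) (w : V -> R) (x : config V) :
  `|\sum_i w i * (x i)%:R| <= \sum_i `|w i|.
Proof.
apply: le_trans (ler_norm_sum _ _ _) _; apply: ler_sum => i _.
by case: (x i); rewrite ?mulr1 // mulr0 normr0.
Qed.

Lemma linear_indicator (R : realType) (V : finType) (B : {set V}) (N : R)
    (x : config V) :
  \sum_i (if i \in B then N else 0) * (x i)%:R
  = N * (#|B|%:R - #|B :\: [set i | x i]|%:R).
Proof.
have -> : #|B|%:R = #|B :&: [set i | x i]|%:R + #|B :\: [set i | x i]|%:R :> R.
  by rewrite -natrD cardsID.
rewrite addrK -sum1_card natr_sum mulr_sumr [RHS]big_mkcond /=.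
apply: eq_bigr => i _; rewrite !inE.
by case: (i \in B); case: (x i); rewrite /= ?mulr0 ?mul0r.
Qed.

(** Subtracting a large [N] for every zero of [x] on [B] switches the unit off
    unless [x] is 1 on all of [B]; there, a large bias [c0] keeps the unit in its
    linear regime. So the limit has no monomial of degree above [#|B|.+1], the
    coefficients of the monomials [j |: B] with [j] outside [B] are free, and
    the price is the huge coefficient [c0] of the monomial [B]. *)
Lemma star_unit (R : realType) (V : finType) (B : {set V}) (w : V -> R) (T : R) :
  0 < T -> exists (w' : V -> R) (c c0 : R), saturated T (affine w' c)
    (fun x => monomial B x * affine w c0 x).
Proof.
move=> T0; set M := \sum_i `|w i|.
have M0 : 0 <= M by apply: sumr_ge0 => i _.
(* c0 - M >= T on the active side and c0 + M - N <= - T on the other. *)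
pose c0 := T + M; pose N := T + c0 + M.
exists (fun i => w i + if i \in B then N else 0), (c0 - N * #|B|%:R), c0 => x.
have -> : affine (fun i => w i + if i \in B then N else 0) (c0 - N * #|B|%:R) x
    = affine w c0 x - N * #|B :\: [set i | x i]|%:R.
  rewrite /affine; under eq_bigr do rewrite mulrDl.
  by rewrite big_split /= linear_indicator; ring.
have := norm_linear_le w x; rewrite -/M ler_norml monomialE => /andP[wl wu].
case: (boolP (B \subset _)) => Bx.
  left; move: Bx; rewrite -setD_eq0 => /eqP->; rewrite cards0 mulr0 subr0 mul1r.
  by split=> //; rewrite /affine /c0; lra.
right; rewrite mul0r; split=> //.
have : (1 : R) <= #|B :\: [set i | x i]|%:R by rewrite ler1n card_gt0 setD_eq0.
rewrite /affine; move: (#|_|%:R) => z z1.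
have : N * 1 <= N * z by apply: ler_wpM2l => //; rewrite /N /c0; lra.
rewrite /N /c0; lra.
Qed.

(** The monomials [B] and [i |: B] receive arbitrary coefficients from one unit.
    With [d = #|B| - 1] and [z] the number of zeros of [x] on [B], the argument
    is [t (1 - z) + u], where [u = (t - a - b x_i) / d]: for large [t] the unit is
    active exactly when [z <= 1]. The value [u] on the configurations with [z = 1]
    forces the coefficient [u] on every [B :\ j]; these add up to
    [#|B| u = (d + 1) u] when [z = 0], and [u] is chosen so that the excess of the
    actual value [t + u] over that sum is [a + b x_i]. The unit is off at [z = 2]
    only if [u < t], and since [u] is close to [t / d] this requires
    [3 <= #|B|]. *)
Lemma edge_unit (R : realType) (V : finType) (B : {set V}) (i : V) (a b T : R) :
  0 < T -> (3 <= #|B|)%N -> i \notin B ->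
  exists (w : V -> R) (c r s : R), saturated T (affine w c)
    (fun x => a * monomial B x + b * monomial (i |: B) x
      + \sum_(j in B) (r * monomial (B :\ j) x + s * monomial (i |: B :\ j) x)).
Proof.
move=> T0 B3 iB; pose d : R := #|B|%:R - 1.
have d2 : 2 <= d by rewrite /d; move: B3; rewrite -(ler_nat R); lra.
pose t := d * T + `|a| + `|b|.
exists (fun j => (if j \in B then t else 0) + if j \in [set i] then - b / d else 0).
exists ((t - a) / d - t * d), ((t - a) / d), (- b / d) => x.
pose u := (t - a - b * (x i)%:R) / d.
pose Z := B :\: [set i | x i].
have duE : d * u = t - a - b * (x i)%:R by rewrite mulrC divfK // gt_eqF //; lra.
have -> : affine (fun j => (if j \in B then t else 0)
      + if j \in [set i] then - b / d else 0) ((t - a) / d - t * d) x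
    = t * (1 - #|Z|%:R) + u.
  rewrite /affine; under eq_bigr do rewrite mulrDl.
  rewrite big_split /= linear_indicator.
  rewrite (bigD1 i) //= big1 => [|j /negPf ji]; last by rewrite inE ji mul0r.
  by rewrite inE eqxx -/Z /u /d; field; rewrite -/d gt_eqF //; lra.
have -> : \sum_(j in B) ((t - a) / d * monomial (B :\ j) x
      + - b / d * monomial (i |: B :\ j) x)
    = u * \sum_(j in B) (Z \subset [set j])%:R.
  rewrite mulr_sumr; apply: eq_bigr => j jB.
  rewrite monomialU1; last by rewrite !inE negb_and iB orbT.
  have -> : monomial (B :\ j) x = (Z \subset [set j])%:R :> R.
    by rewrite monomialE !subDset setUC.
  by rewrite /u; ring.
rewrite monomialU1 // monomialE.
(* The first bound makes the unit saturated at z <= 1, the second, which rests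
   on d >= 2, at z >= 2. *)
have Tle : d * T <= d * u /\ d * T + d * u <= d * t.
  have dT : 2 * T <= d * T by rewrite ler_pM2r.
  have dt : 2 * t <= d * t.
    by apply: ler_wpM2r => //; rewrite /t; have := normr_ge0 a; have := normr_ge0 b; lra.
  rewrite duE; move: dT dt; rewrite /t.
  have := ler_norm a; have := ler_norm b.
  have := ler_norm (- a); have := ler_norm (- b).
  rewrite !normrN; have := normr_ge0 a; have := normr_ge0 b.
  by case: (x i); rewrite ?mulr1 ?mulr0; split; lra.
have d0 : 0 < d by lra.
have {Tle} [uT tuT] : T <= u /\ T + u <= t.
  by move: Tle; rewrite -mulrDr !ler_pM2l.
have [Z0|Zn0] := eqVneq Z set0.
  left; rewrite -setD_eq0 -/Z Z0 eqxx cards0.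
  under eq_bigr do rewrite sub0set.
  rewrite sumr_const; split; first by lra.
  have -> : u * (true%:R *+ #|B|) = d * u + u.
    by rewrite -[true%:R *+ _]mulr_natl mulr1 /d; ring.
  by rewrite !mulr1 duE; ring.
have BxF : B \subset [set i | x i] = false by rewrite -setD_eq0 (negPf Zn0).
rewrite BxF !mulr0 !add0r.
(* A single zero k on B: only the monomial B :\ k survives in the sum. *)
have [/eqP/cards1P[k Zk]|Z1] := eqVneq #|Z| 1%N.
  left; have kB : k \in B by have : k \in Z by [rewrite Zk inE]; rewrite inE => /andP[].
  rewrite Zk cards1 (bigD1 k) //= subxx big1 => [|j /andP[_ /negPf jk]].
    by rewrite subrr mulr0 add0r addr0 mulr1.
  by rewrite sub1set inE eq_sym jk.
right; rewrite big1 ?mulr0 => [|j _].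
  split=> //; have Z2 : (2 : R) <= #|Z|%:R.
    by rewrite ler_nat ltn_neqAle eq_sym Z1 card_gt0.
  by nra.
rewrite (_ : Z \subset _ = false) //; apply: contraNF Z1 => /subset_leq_card.
by rewrite cards1 eqn_leq card_gt0 Zn0 andbT.
Qed.

(** * Removing monomials with one unit *)

Definition spanned (R : realType) (V : finType) (Q : pred {set V})
    (f : config V -> R) : Prop :=
  exists2 J : {set V} -> R, (forall L, ~~ Q L -> J L = 0)
    & forall x, f x = \sum_L J L * monomial L x.

Lemma spanned_ext (R : realType) (V : finType) (Q : pred {set V})
    (f g : config V -> R) : spanned Q f -> g =1 f -> spanned Q g.
Proof. by case=> J JQ fE gf; exists J => // x; rewrite gf. Qed.

Lemma spannedD (R : realType) (V : finType) (Q : pred {set V})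
    (f g : config V -> R) :
  spanned Q f -> spanned Q g -> spanned Q (fun x => f x + g x).
Proof.
case=> J JQ fE [K KQ gE]; exists (fun L => J L + K L) => [L nQ|x].
  by rewrite JQ // KQ // addr0.
by rewrite fE gE -big_split /=; apply: eq_bigr => L _; rewrite mulrDl.
Qed.

Lemma spanned_monomial (R : realType) (V : finType) (Q : pred {set V})
    (r : R) (L : {set V}) : Q L -> spanned Q (fun x => r * monomial L x).
Proof.
move=> QL; exists (fun K => if K == L then r else 0) => [K|x].
  by case: eqVneq => // ->; rewrite QL.
rewrite (bigD1 L) //= eqxx big1 ?addr0 // => K /negPf->; exact: mul0r.
Qed.

Lemma spanned_sum (R : realType) (V I : finType) (Q : pred {set V})
    (P : pred I) (f : I -> config V -> R) :
  (forall i, P i -> spanned Q (f i)) -> spanned Q (fun x => \sum_(i | P i) f i x).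
Proof.
move=> fQ; suff H (r : seq I) : spanned Q (fun x => \sum_(i <- r | P i) f i x) by exact: H.
elim: r => [|i r IH].
  exists (fun=> 0) => // x; rewrite big_nil big1 // => L _; exact: mul0r.
case: (boolP (P i)) => Pi.
  by apply: spanned_ext (spannedD (fQ i Pi) IH) _ => x; rewrite big_cons Pi.
by apply: spanned_ext IH _ => x; rewrite big_cons (negPf Pi).
Qed.

(** One hidden unit can take over the monomials of [A], whatever their
    coefficients and up to an error as small as desired, if the function that is
    left for the other units may use the monomials of [Q], with arbitrarily large
    coefficients. *)
Definition peelable (R : realType) (V : finType) (A : {set {set V}})
    (Q : pred {set V}) : Prop :=
  forall (J : {set V} -> R) (T : R), 0 < T ->
    exists (w : V -> R) (c : R) (g : config V -> R),
      saturated T (affine w c) g /\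
      spanned Q (fun x => \sum_(L in A) J L * monomial L x - g x).

Lemma peelable_star (R : realType) (V : finType) (B B' : {set V})
    (A : {set {set V}}) (Q : pred {set V}) :
  [disjoint B & B'] -> A \subset [set j |: B | j in B'] -> Q B ->
  peelable R A Q.
Proof.
move=> dBB' AB QB J T T0.
pose D := [set j in B' | j |: B \in A].
have DB j : j \in D -> j \notin B.
  by rewrite inE => /andP[jB' _]; rewrite (disjointFl dBB' jB').
have AE : A = [set j |: B | j in D].
  apply/setP => L; apply/idP/imsetP => [LA|[j]]; last by rewrite inE => /andP[_ jA] ->.
  by have /imsetP[j jB' LE] := subsetP AB _ LA; exists j => //; rewrite inE jB' -LE.
have Dinj : {in D &, injective (fun j => j |: B)}.
  move=> j k jD kD /setP/(_ j); rewrite !inE eqxx /= (negPf (DB j jD)) orbF.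
  by move/esym/eqP.
pose w j := if j \in D then J (j |: B) else 0.
have [w' [c [c0 sat]]] := star_unit B w T0.
exists w', c, (fun x => monomial B x * affine w c0 x); split=> //.
apply: spanned_ext (spanned_monomial (- c0) QB) _ => x.
rewrite AE big_imset //= /affine (bigID (mem D) predT) /=.
rewrite [X in _ + X + c0]big1 => [|j /negPf jD]; last by rewrite /w jD mul0r.
rewrite addr0 mulrDr mulr_sumr opprD addrA.
suff -> : \sum_(j in D) J (j |: B) * monomial (j |: B) x
    = \sum_(j in D) monomial B x * (w j * (x j)%:R).
  by rewrite subrr add0r mulNr mulrC.
apply: eq_bigr => j jD; rewrite /w jD monomialU1 ?DB //.
by rewrite [RHS]mulrC -mulrA.
Qed.

Lemma peelable_set0 (R : realType) (V : finType) (Q : pred {set V}) :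
  Q set0 -> peelable R set0 Q.
Proof.
apply: (@peelable_star _ _ set0 set0) (sub0set _).
by rewrite disjoints_subset sub0set.
Qed.

Lemma peelable_set1 (R : realType) (V : finType) (L : {set V}) (j : V)
    (Q : pred {set V}) :
  j \in L -> Q (L :\ j) -> peelable R [set L] Q.
Proof.
move=> jL; apply: (@peelable_star _ _ (L :\ j) [set j]).
- by rewrite disjoint_sym disjoints1 !inE eqxx.
- by rewrite sub1set imset_set1 inE setD1K.
Qed.

Lemma peelable_edge (R : realType) (V : finType) (B : {set V}) (i : V)
    (Q : pred {set V}) :
  (3 <= #|B|)%N -> i \notin B ->
  (forall C : {set V}, C \subset i |: B -> C != B -> C != i |: B -> Q C) ->
  peelable R [set i |: B; B] Q.
Proof.
move=> B3 iB QC J T T0.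
have [w [c [r [s sat]]]] := edge_unit (J B) (J (i |: B)) T0 B3 iB.
exists w, c; eexists; split; first exact: sat.
have QB j : j \in B -> Q (B :\ j) /\ Q (i |: B :\ j).
  move=> jB; have ij : i != j by apply: contraNneq iB => ->.
  split; apply: QC.
  - exact: subset_trans (subsetDl _ _) (subsetUr _ _).
  - by apply: contraTneq jB => <-; rewrite !inE eqxx.
  - by apply: contraNneq iB => /setP/(_ i); rewrite !inE eqxx /= => /andP[].
  - by rewrite setUS ?subsetDl.
  - by apply: contraNneq iB => <-; rewrite !inE eqxx.
  - by apply: contraTneq jB => /setP/(_ j); rewrite !inE eqxx (eq_sym j) (negPf ij) /= => <-.
have lower : spanned Q (fun x => \sum_(j in B)
    (- r * monomial (B :\ j) x + - s * monomial (i |: B :\ j) x)).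
  by apply: spanned_sum => j /QB[Q1 Q2]; apply: spannedD; exact: spanned_monomial.
apply: spanned_ext lower _ => x.
have iBB : i |: B \notin [set B].
  by rewrite inE; apply: contraNneq iB => <-; rewrite !inE eqxx.
rewrite big_setU1 //= big_set1.
have -> : \sum_(j in B) (- r * monomial (B :\ j) x + - s * monomial (i |: B :\ j) x)
    = - \sum_(j in B) (r * monomial (B :\ j) x + s * monomial (i |: B :\ j) x).
  by rewrite -sumrN; apply: eq_bigr => j _; ring.
ring.
Qed.

(** * Peeling off the layers of an energy *)

Lemma spanned_affine (R : realType) (V : finType) (Q : pred {set V})
    (f : config V -> R) :
  (forall L, Q L -> (#|L| <= 1)%N) -> spanned Q f ->
  exists (b : V -> R) (c : R), f =1 affine b c.
Proof.
move=> Q1 [J JQ fE]; exists (fun i => J [set i]), (J set0) => x.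
rewrite fE /affine.
pose sm (L : {set V}) := L \in [set [set i] | i in [set: V]].
rewrite (bigD1 set0) //= {1}/monomial big_set0 mulr1 addrC; congr (_ + _).
rewrite (bigID sm) /= [X in _ + X]big1 ?addr0; last first.
  move=> L /andP[L0 nsm]; rewrite JQ ?mul0r //; apply: contra nsm => /Q1 L1.
  have /cards1P[i ->] : #|L| == 1%N by rewrite eqn_leq L1 card_gt0.
  exact: imset_f.
rewrite (eq_bigl sm) => [|L]; last first.
  apply: andb_idl => /imsetP[i _ ->]; apply/set0Pn; exists i; exact: set11.
rewrite big_imset /=; last by move=> i j _ _; exact: set1_inj.
by apply: eq_big => [i|i _]; rewrite ?inE // /monomial big_set1.
Qed.

(** Layer after layer, the limit function of one unit is subtracted. What remains
    is an exact combination of the monomials of the later layers, so the units do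
    not interact: only the saturation errors add up, and they can be chosen after
    the coefficients that the previous units have produced. *)
Lemma peel_layers (R : realType) (V : finType) (h : nat)
    (A : nat -> {set {set V}}) (Q : nat -> pred {set V})
    (f : config V -> R) (eps : R) :
  (forall k, (k < h)%N -> peelable R (A k) (Q k.+1)) ->
  (forall k L, (k < h)%N -> Q k L -> L \in A k \/ Q k.+1 L) ->
  (forall L, Q h L -> (#|L| <= 1)%N) ->
  spanned (Q 0%N) f -> 0 < eps ->
  exists (b : V -> R) (b0 : R) (w : nat -> V -> R) (c : nat -> R),
    forall x, `|f x - (affine b b0 x
      + \sum_(k < h) softplus (affine (w k) (c k) x))| <= eps.
Proof.
elim: h A Q f eps => [|h IH] A Q f eps Apeel Qlayer Q1 fQ eps0.
  have [b [b0 fE]] := spanned_affine Q1 fQ.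
  exists b, b0, (fun _ _ => 0), (fun=> 0) => x.
  by rewrite big_ord0 addr0 fE subrr normr0 ltW.
have [J JQ fE] := fQ.
(* Saturation at T = |ln (eps / 2)| + 1 makes expR (- T) at most eps / 2. *)
have eps2 : 0 < eps / 2 by rewrite divr_gt0.
have [w0 [c0 [g [sat rest]]]] :=
  Apeel 0%N isT J (`|ln (eps / 2)| + 1) (ltr_wpDl (normr_ge0 _) ltr01).
have fgQ : spanned (Q 1%N) (fun x => f x - g x).
  have high : spanned (Q 1%N) (fun x => \sum_(L | L \notin A 0%N) J L * monomial L x).
    apply: spanned_sum => L LA; case: (boolP (Q 1%N L)) => QL; first exact: spanned_monomial.
    have -> : J L = 0.
      by apply: JQ; apply: contra QL => /(Qlayer 0%N L isT)[]; rewrite // (negPf LA).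
    by exists (fun=> 0) => // x; rewrite mul0r big1 // => K _; exact: mul0r.
  apply: spanned_ext (spannedD rest high) _ => x.
  by rewrite fE (bigID (mem (A 0%N))) /= addrAC.
have [||b [b0 [w [c approx]]]] := IH (A \o succn) (Q \o succn) _ _ _ _ Q1 fgQ eps2.
- by move=> k kh; exact: Apeel.
- by move=> k L kh; exact: Qlayer.
exists b, b0, (fun k => if k is k'.+1 then w k' else w0).
exists (fun k => if k is k'.+1 then c k' else c0) => x.
rewrite big_ord_recl /= addrCA opprD addrA.
have := approx x; have := saturated_softplus sat x.
set s := softplus _; set y := affine b b0 x + _ => sg fy.
have -> : f x - s - y = (f x - g x - y) - (s - g x) by ring.
apply: le_trans (ler_normB _ _) _; rewrite [leRHS]splitr lerD //.
apply: le_trans sg _; rewrite -ler_ln ?posrE ?expR_gt0 // expRK.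
by have := ler_norm (- ln (eps / 2)); rewrite normrN; lra.
Qed.

Lemma rbm_layers (R : realType) (V H : finType) (b : V -> R) (b0 : R)
    (w : nat -> V -> R) (c : nat -> R) (x : config V) :
  affine b b0 x + \sum_(k < #|H|) softplus (affine (w k) (c k) x)
  = b0 + rbm_energy b (fun j : H => w (enum_rank j)) (fun j => c (enum_rank j)) x.
Proof.
rewrite /affine addrAC addrC /rbm_energy; congr (_ + (_ + _)).
rewrite (reindex (@enum_rank H)) //=; apply: onW_bij; exact: enum_rank_bij.
Qed.

Lemma edge_pair_setU1 (V : finType) (B B' : {set V}) :
  edge_pair B B' -> exists2 i, i \notin B' & B = i |: B'.
Proof.
case=> B'B noC; have [/subsetP B'subB [i iB iB']] := properP B'B; exists i => //.
apply/eqP; rewrite eq_sym; apply: contra_notT noC => neB; exists (i |: B').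
rewrite properUr ?sub1set // properEneq neB subUset sub1set iB.
by split=> //; exact/subsetP.
Qed.

Theorem theorem8 (R : realType) (V : finType) (S : {set {set V}}) (H : finType)
    (V_nonempty : (0 < #|V|)%N)
    (S_complex : simplicial_complex S)
    (S_cover : cover S = [set: V])
    (BB_ex : exists BB : 'I_#|H| -> {set {set V}},
      (forall j,
         star_tuple (BB j) \/
         exists B B' : {set V},
           [/\ edge_pair B B', (3 <= #|B|)%N, (3 <= #|B'|)%N
             & BB j = [set B; B']])
      /\ covers_reverse_inclusion BB [set L in S | (2 <= #|L|)%N])
    (p : config V -> R) :
  hierarchical_model S p -> approximable (rbm H) p.
Proof.
case: BB_ex => BB [BBtype [sigma [sigmaBB sigma_mono]]] [J pE] eps eps0.
set F := [set L in S | _] in sigma sigmaBB sigma_mono.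
pose s L : nat := if insub L is Some u then sigma u else 0%N.
have sE L (LF : L \in F) : s L = sigma (exist _ L LF) by rewrite /s insubT.
have s_lt L : L \in F -> (s L < #|H|)%N by move=> LF; rewrite (sE L LF).
have sBB L (k : 'I_#|H|) : L \in F -> s L = k :> nat -> L \in BB k.
  move=> LF; rewrite (sE L LF) => /val_inj <-; exact: (sigmaBB (exist _ L LF)).
have s_mono L L' : L \in F -> L' \in F -> L' \proper L -> (s L <= s L')%N.
  move=> LF LF' LL'; rewrite (sE L LF) (sE L' LF').
  exact: (sigma_mono (exist _ L LF) (exist _ L' LF')).
have F_sub (L L' : {set V}) : L \in F -> L' \subset L -> (2 <= #|L'|)%N -> L' \in F.
  by rewrite !inE => /andP[LS _] L'L ->; rewrite (S_complex _ _ LS L'L).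
(* Unit k has to produce the coefficients of A k; the monomials of Q k are those
   still available when its turn comes. *)
pose A (k : nat) := [set L in F | s L == k].
pose Q k (L : {set V}) := (#|L| <= 1)%N || (L \in F) && (k <= s L)%N.
(* Here the reverse inclusion order is used: a proper subset of a member of A k
   which is not in A k itself is left to a later unit or to the biases. *)
have Qlow k (L C : {set V}) : L \in A k -> C \proper L -> C \notin A k -> Q k.+1 C.
  rewrite inE => /andP[LF /eqP sL] CL CA; rewrite /Q.
  case: (leqP #|C| 1) => //= C2; have CF := F_sub _ _ LF (proper_sub CL) C2.
  move: CA; rewrite inE CF /= => sC.
  by rewrite ltn_neqAle eq_sym sC -sL s_mono.
have Q0 k : Q k set0 by rewrite /Q cards0.
have A_BB (k : 'I_#|H|) L : L \in A k -> L \in BB k.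
  by rewrite inE => /andP[LF /eqP]; exact: sBB.
have peel1 k L : A k = [set L] -> peelable R (A k) (Q k.+1).
  move=> AL; have LA : L \in A k by rewrite AL set11.
  have /card_gt0P[j jL] : (0 < #|L|)%N.
    by move: LA; rewrite !inE => /andP[/andP[_ /ltnW]].
  rewrite {1}AL; apply: (peelable_set1 jL).
  apply: (Qlow k L _ LA); first exact: properD1.
  by rewrite AL inE; apply: contraTneq jL => <-; rewrite !inE eqxx.
have peel k : (k < #|H|)%N -> peelable R (A k) (Q k.+1).
  move=> kH; have [A0|[L0 L0A]] := set_0Vmem (A k).
    by rewrite A0; exact: peelable_set0 (Q0 _).
  have A_BBk L : L \in A k -> L \in BB (Ordinal kH) by exact: (A_BB (Ordinal kH)).
  case: (BBtype (Ordinal kH)) => [[B [B' [dBB' BBE]]]|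
      [B [B' [/edge_pair_setU1[i iB' BE] _ B'3 BBE]]]].
    have new j : j \in B' -> j \notin B by move=> jB'; rewrite (disjointFl dBB' jB').
    apply: (peelable_star dBB'); first by apply/subsetP => L; rewrite -BBE; exact: A_BBk.
    have /imsetP[j jB' L0E] : L0 \in [set j |: B | j in B'] by rewrite -BBE A_BBk.
    apply: (Qlow k L0 _ L0A); first by rewrite L0E properUr // sub1set new.
    apply/negP => /A_BBk; rewrite BBE => /imsetP[i iB' BE].
    by move: (new i iB'); rewrite BE !inE eqxx.
  have A_sub L : L \in A k -> L = B \/ L = B'.
    by move/A_BBk; rewrite BBE !inE => /orP[] /eqP; [left | right].
  (* An edge pair of which only one set is assigned to unit k acts as a star. *)
  have [BA|BA] := boolP (B \in A k); last first.
    apply: (peel1 k B'); apply/setP => L; rewrite inE; apply/idP/eqP => [LA|->].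
      by case: (A_sub L LA) => // LB; rewrite LB (negPf BA) in LA.
    by case: (A_sub L0 L0A) => L0E; rewrite L0E in L0A => //; rewrite L0A in BA.
  have [B'A|B'A] := boolP (B' \in A k); last first.
    apply: (peel1 k B); apply/setP => L; rewrite inE; apply/idP/eqP => [LA|-> //].
    by case: (A_sub L LA) => // LB; rewrite LB (negPf B'A) in LA.
  have AE : A k = [set i |: B'; B'].
    apply/setP => L; rewrite -BE; apply/idP/set2P => [/A_sub//|].
    by case=> ->.
  rewrite AE; apply: peelable_edge => // C CB CB' CnB.
  by apply: (Qlow k B _ BA); rewrite ?AE ?BE ?properEneq ?CnB // !inE negb_or CB' CnB.
have layer k L : (k < #|H|)%N -> Q k L -> L \in A k \/ Q k.+1 L.
  move=> _ /orP[L1|/andP[LF]]; first by right; rewrite /Q L1.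
  rewrite leq_eqVlt => /orP[/eqP kE|kL]; first by left; rewrite inE LF kE eqxx.
  by right; rewrite /Q LF kL orbT.
have last_layer L : Q #|H| L -> (#|L| <= 1)%N.
  by case/orP => // /andP[/s_lt]; rewrite ltnNge => /negPf->.
have energyQ : spanned (Q 0%N) (hierarchical_energy S J).
  apply: spanned_sum => L LS; apply: spanned_monomial.
  by rewrite /Q inE LS leq0n andbT; case: ltnP.
have [d d0 close] := gibbs_continuous (hierarchical_energy S J) eps0.
have [b [b0 [w [c approx]]]] := peel_layers peel layer last_layer energyQ d0.
exists (gibbs (rbm_energy b (fun j : H => w (enum_rank j)) (fun j => c (enum_rank j)))).
split; first by exists b, (fun j => w (enum_rank j)), (fun j => c (enum_rank j)).
apply/bigmax_leP; split=> [|x _]; first exact: ltW.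
rewrite pE; apply: (close _ b0) => y; rewrite -rbm_layers; exact: approx.
Qed.
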